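(* Let $f:(0,\infty)\to\mathbb{R}$ be a convex or concave function, and consider log-concave functions $\varphi:\mathbb{R}^n\to[0,\infty)$ (all functions involved having the smoothness and integrability stated in the context). Then: (1) $D_f$ is invariant under self-adjoint $SL(n)$ maps: $D_f(\varphi\circ A)=D_f(\varphi)$ for every log-concave $\varphi$ and every self-adjoint linear map $A:\mathbb{R}^n\to\mathbb{R}^n$ with $\det A=1$. (2) $D_f$ is a valuation: if $\varphi_1,\varphi_2$ are log-concave and $\max(\varphi_1,\varphi_2)$ is log-concave, then $$D_f(\varphi_1)+D_f(\varphi_2)=D_f(\max(\varphi_1,\varphi_2))+D_f(\min(\varphi_1,\varphi_2)).$$
   Context: A function $\varphi:\mathbb{R}^n\to[0,\infty)$ is log-concave if $\varphi=e^{-\psi}$ with $\psi:\mathbb{R}^n\to\mathbb{R}$ convex; $\mathrm{supp}(\varphi)=\{x:\varphi(x)>0\}$. The $f$-divergence of $\varphi$ (written $D_f(P_\varphi,Q_\varphi)$ or $D_f(\varphi)$) is $$D_f(\varphi)=\int_{\mathrm{supp}(\varphi)}\varphi\; f\!\left(\frac{e^{\langle\nabla\varphi,x\rangle/\varphi}}{\varphi^2}\,\det\left[\mathrm{Hess}(-\ln\varphi)\right]\right)dx,$$ with the convention $f(0)=\lim_{t\downarrow0}f(t)$, $0\cdot\infty=0$. Standing assumption: the functions are integrable, have enough smoothness on their supports ($C^2$), $-\ln\varphi$ is strictly convex, and the integrands are integrable, so that all expressions considered make sense. *)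

(* Defs.v *)
From HB Require Import structures.
From mathcomp Require Import all_boot all_order all_algebra.
From mathcomp Require Import all_classical all_reals all_analysis.

Set Implicit Arguments.
Unset Strict Implicit.
Unset Printing Implicit Defensive.

Import Order.TTheory GRing.Theory Num.Theory.
Import numFieldNormedType.Exports.

Local Open Scope classical_set_scope.
Local Open Scope ring_scope.

(* The sigma-algebra on R^n is generated by the coordinate maps, exactly as   *)
(* the library does for n.-tuple; it is the Borel sigma-algebra of R^n.       *)
Definition measure_rV_display : measure_display -> measure_display.
Proof. exact. Qed.

Section measurable_rV.
Variables (R : realType) (n : nat).

Let coors : 'I_n -> 'rV[R]_n -> measurableTypeR R := fun i x => x ord0 i.

Let rV_set0 : g_sigma_preimage coors set0.
Proof. exact: sigma_algebra0. Qed.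

Let rV_setC A : g_sigma_preimage coors A -> g_sigma_preimage coors (~` A).
Proof. exact: sigma_algebraC. Qed.

Let rV_bigcup (F : (set 'rV[R]_n)^nat) :
  (forall i, g_sigma_preimage coors (F i)) ->
  g_sigma_preimage coors (\bigcup_i (F i)).
Proof. exact: sigma_algebra_bigcup. Qed.

HB.instance Definition _ :=
  @isMeasurable.Build (measure_rV_display default_measure_display)
    'rV[R]_n (g_sigma_preimage coors) rV_set0 rV_setC rV_bigcup.

End measurable_rV.

Lemma measurable_coord (R : realType) n (i : 'I_n) :
  measurable_fun [set: 'rV[R]_n]
    ((fun x => x ord0 i) : 'rV[R]_n -> measurableTypeR R).
Proof.
move=> _ Y mY; rewrite setTI; apply: sub_sigma_algebra => /=.
rewrite -bigcup_seq/=; exists i => /=; first by rewrite mem_index_enum.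
by exists Y => //; rewrite setTI.
Qed.

Lemma measurable_fun_rVP d (T : measurableType d) (R : realType) n
    (f : T -> 'rV[R]_n) :
  (forall i, measurable_fun [set: T]
     ((fun t => f t ord0 i) : T -> measurableTypeR R)) ->
  measurable_fun [set: T] f.
Proof.
move=> mf _; apply: smallest_sub => /=.
  split.
  - by rewrite preimage_set0 setI0; exact: measurable0.
  - move=> A; rewrite !setTI setTD => mA.
    by rewrite preimage_setC; exact: measurableC.
  - move=> F mF; rewrite setTI preimage_bigcup.
    by apply: bigcup_measurable => k _; have := mF k; rewrite setTI.
rewrite -bigcup_seq; apply: bigcup_sub => i _ A [B mB <-].
by rewrite setTI -comp_preimage; exact: mf.
Qed.

(* Lebesgue measure on R^n, as the n-fold product of the library's measure on *)
(* R, transported along (x, v) |-> (x, v_0, ..., v_(n-1)).                     *)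
Definition rV_cons (R : realType) n (p : (measurableTypeR R * 'rV[R]_n)%type) :
  'rV[R]_n.+1 := row_mx (p.1%:M : 'M[R]_1) p.2.

Lemma measurable_rV_cons (R : realType) n :
  measurable_fun [set: measurableTypeR R * 'rV[R]_n] (@rV_cons R n).
Proof.
apply: measurable_fun_rVP => i.
case: (@split_ordP 1 n i) => j ->.
- rewrite (_ : (fun t => _) = fst); first exact: measurable_fst.
  by apply/funext => t; rewrite [LHS]row_mxEl mxE [j]ord1 eqxx mulr1n.
- rewrite (_ : (fun t => _) =
    ((fun x : 'rV[R]_n => x ord0 j) : 'rV[R]_n -> measurableTypeR R) \o snd).
    by apply: measurableT_comp; [exact: measurable_coord|exact: measurable_snd].
  by apply/funext => t; rewrite [LHS]row_mxEr.
Qed.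

HB.instance Definition _ (R : realType) n :=
  isMeasurableFun.Build _ _ _ _ (@rV_cons R n) (@measurable_rV_cons R n).

Definition rV_uncons (R : realType) n (x : 'rV[R]_n.+1) :
    (measurableTypeR R * 'rV[R]_n)%type :=
  (x ord0 ord0, \row_j x ord0 (lift ord0 j)).

Lemma rV_consK (R : realType) n : cancel (@rV_cons R n) (@rV_uncons R n).
Proof.
move=> [x v]; congr pair => /=.
  have x00 : (x%:M : 'M[R]_1) ord0 ord0 = x by rewrite mxE eqxx mulr1n.
  rewrite -[RHS]x00 -(@row_mxEl R 1 1 n x%:M v ord0 ord0) /rV_cons /=.
  by congr (row_mx _ _ _ _); exact/val_inj.
apply/rowP => j; rewrite mxE -[RHS](@row_mxEr R 1 1 n x%:M) /rV_cons /=.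
by congr (row_mx _ _ _ _); exact/val_inj.
Qed.

Lemma measurable_rV_uncons (R : realType) n :
  measurable_fun [set: 'rV[R]_n.+1] (@rV_uncons R n).
Proof.
apply: measurable_fun_pair => /=; first exact: measurable_coord.
apply: measurable_fun_rVP => i.
rewrite (_ : (fun t => _) = fun x : 'rV[R]_n.+1 => x ord0 (lift ord0 i)).
  exact: measurable_coord.
by apply/funext => x; rewrite mxE.
Qed.

Section lebesgue_rV_step.
Context (R : realType) (n : nat).
Variable mu : {sigma_finite_measure set 'rV[R]_n -> \bar R}.

Definition lebesgue_rV_step : set 'rV[R]_n.+1 -> \bar R :=
  pushforward (@lebesgue_measure R \x mu)%E (@rV_cons R n).

Let step0 : lebesgue_rV_step set0 = 0%E.
Proof. exact: measure0. Qed.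

Let step_ge0 A : (0 <= lebesgue_rV_step A)%E.
Proof. exact: measure_ge0. Qed.

Let step_sigma_additive : semi_sigma_additive lebesgue_rV_step.
Proof. exact: measure_semi_sigma_additive. Qed.

HB.instance Definition _ := isMeasure.Build _ _ _ lebesgue_rV_step
  step0 step_ge0 step_sigma_additive.

Let step_sigma_finite : sigma_finite setT lebesgue_rV_step.
Proof.
have /sigma_finiteP[F [TF ndF Foo]] := sigma_finiteT (@lebesgue_measure R).
have /sigma_finiteP[G [TG ndG Goo]] := sigma_finiteT mu.
exists (fun i => @rV_uncons R n @^-1` (F i `*` G i)).
  rewrite -preimage_bigcup (_ : \bigcup_i _ = setT) ?preimage_setT//.
  apply/seteqP; split => // -[x y] _.
  have [k _ Fkx] : (\bigcup_i F i) x by rewrite -TF.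
  have [l _ Gly] : (\bigcup_i G i) y by rewrite -TG.
  exists (maxn k l) => //; split => /=.
  - by move: x Fkx; exact/subsetPset/ndF/leq_maxl.
  - by move: y Gly; exact/subsetPset/ndG/leq_maxr.
move=> i; have [mF Fi] := Foo i; have [mG Gi] := Goo i; split.
  rewrite -[X in measurable X]setTI; apply: measurable_rV_uncons => //.
  exact: measurableX.
rewrite /lebesgue_rV_step /pushforward -comp_preimage.
rewrite (_ : @rV_uncons R n \o _ = id); last first.
  by apply/funext => p; exact: rV_consK.
by rewrite preimage_id product_measure1E// lte_mul_pinfty// ge0_fin_numE.
Qed.

HB.instance Definition _ := Measure_isSigmaFinite.Build _ _ _
  lebesgue_rV_step step_sigma_finite.

End lebesgue_rV_step.

Fixpoint lebesgue_rV (R : realType) (n : nat) :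
    {sigma_finite_measure set 'rV[R]_n -> \bar R} :=
  if n is m.+1 then lebesgue_rV_step (lebesgue_rV R m) else \d_ (0 : 'rV[R]_0).

Section calculus.
Context (R : realType) (n : nat).
Implicit Types (g : 'rV[R]_n -> R) (U : set 'rV[R]_n) (x y : 'rV[R]_n).

Definition dotv x y : R := \sum_i x ord0 i * y ord0 i.

Definition partial (i : 'I_n) g : 'rV[R]_n -> R :=
  fun x => 'D_(delta_mx ord0 i) g x.

Definition grad g x : 'rV[R]_n := \row_i partial i g x.

Definition hess g x : 'M[R]_n := \matrix_(i, j) partial i (partial j g) x.

Definition C1_on U g := forall x, U x -> forall i : 'I_n,
  derivable g x (delta_mx ord0 i) /\ {for x, continuous (partial i g)}.

Definition C2_on U g := C1_on U g /\ forall i : 'I_n, C1_on U (partial i g).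

Definition strictly_convex_on U g := forall x y (t : R),
  U x -> U y -> x != y -> 0 < t < 1 ->
  g ((1 - t) *: x + t *: y) < (1 - t) * g x + t * g y.

End calculus.

(* psi is real-valued, hence a log-concave phi is positive everywhere.        *)
Definition log_concave (R : realType) n (phi : 'rV[R]_n -> R) :=
  exists2 psi : 'rV[R]_n -> R, convex_function [set: 'rV[R]_n] psi &
    forall x, phi x = expR (- psi x).

Definition supp (R : realType) n (phi : 'rV[R]_n -> R) : set 'rV[R]_n :=
  [set x | 0 < phi x].

Definition convex_or_concave (R : realType) (f : R -> R) :=
  convex_function (`]0, +oo[%classic : set R) f \/
  convex_function (`]0, +oo[%classic : set R) (fun t => - f t).

(* f is only used on ]0, +oo[; its value at 0 is the limit at 0^+, which      *)
(* exists in \bar R (and may be infinite) for f convex or concave.            *)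
Definition ext0 (R : realType) (f : R -> R) (t : R) : \bar R :=
  if 0 < t then (f t)%:E else lim ((f s)%:E @[s --> 0^'+]).

Section f_divergence.
Context (R : realType) (n : nat) (f : R -> R).
Implicit Type phi : 'rV[R]_n -> R.

Definition fdiv_arg phi x : R :=
  expR (dotv (grad phi x) x / phi x) / phi x ^+ 2 *
  \det (hess (fun y => - ln (phi y)) x).

Definition fdiv_integrand phi x : \bar R :=
  ((phi x)%:E * ext0 f (fdiv_arg phi x))%E.

Definition fdiv phi : \bar R :=
  (\int[lebesgue_rV R n]_(x in supp phi) fdiv_integrand phi x)%E.

(* Integrability, C^2 smoothness, strict convexity of -ln phi and             *)
(* integrability of the integrand: assumed of every function considered.      *)
Definition admissible phi :=
  [/\ (lebesgue_rV R n).-integrable [set: 'rV[R]_n] (EFin \o phi),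
      C2_on (supp phi) phi,
      strictly_convex_on (supp phi) (fun x => - ln (phi x)) &
      (lebesgue_rV R n).-integrable (supp phi) (fdiv_integrand phi)].

End f_divergence.

Definition self_adjoint (R : realType) n (A : {linear 'rV[R]_n -> 'rV[R]_n}) :=
  forall x y, dotv (A x) y = dotv x (A y).

(* Main.v *)
Require Import Defs.
From HB Require Import structures.
From mathcomp Require Import all_boot all_order all_algebra.
From mathcomp Require Import all_classical all_reals all_analysis.
From mathcomp Require Import measurable_realfun ring.

Set Implicit Arguments.
Unset Strict Implicit.
Unset Printing Implicit Defensive.

Import Order.TTheory GRing.Theory Num.Theory.
Import numFieldNormedType.Exports.

Local Open Scope classical_set_scope.
Local Open Scope ring_scope.

(** Log-concave functions are positive here, so every integral is over the
    whole of R^n and both parts reduce to pointwise identities between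
    integrands followed by one fact about integration.

    Part (1).  By the chain rule, the gradient and the Hessian of -ln phi
    transform under x |-> A x by the matrix of A on one side, respectively on
    both sides; since <A^T g, x> = <g, A x> and det A = 1, the integrand of
    phi o A at x is the integrand of phi at A x ([fdiv_arg_lin_comp]).  It
    remains to change variables, i.e. to see that a matrix of determinant 1
    preserves Lebesgue measure ([volume_preserving_SL]).  As Lebesgue measure on
    R^(n+1) is a product of R and R^n, Fubini reduces shears in the first row or
    column to translations, and matrices acting on the last n coordinates only
    to dimension n; Gaussian elimination writes every matrix of determinant 1
    as a product of these.

    Part (2).  At every point, the integrands of max(phi1, phi2) and of
    min(phi1, phi2) are those of phi1 and phi2 in some order
    ([fdiv_integrand_max_min]).  This is clear on the open set L where
    phi1 < phi2, and on the open complement of the closure of L, where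
    phi2 <= phi1.  The remaining points lie on the boundary of L; there the
    identification of 2-jets valid on L persists, because all four functions are
    C^2, so that gradients and Hessians are continuous
    ([fdiv_arg_eq_closure]).

    Smoothness is given by partial derivatives; both parts rest on the fact that
    continuous partial derivatives imply Frechet differentiability
    ([C1_diff]). *)

(** * Functions with continuous partial derivatives *)

(** Reduces differentiation along a direction to one real variable, where the
    mean value theorem is available. *)
Lemma is_derive_line (R : numFieldType) (V W : normedModType R) (g : V -> W)
    (y v : V) (s : R) :
  derivable g (s *: v + y) v ->
  is_derive s 1 (fun t : R => g (t *: v + y)) ('D_v g (s *: v + y)).
Proof.
have eq_quotient :
    (fun h : R => h^-1 *: (((fun t : R => g (t *: v + y)) \o shift s) (h *: 1)
                           - (fun t : R => g (t *: v + y)) s)) =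
    (fun h : R => h^-1 *: ((g \o shift (s *: v + y)) (h *: v)
                           - g (s *: v + y))).
  by apply/funext => h /=; rewrite [_%:A]mulr1 scalerDl addrA.
by move=> dg; apply: DeriveDef; rewrite /derivable /derive eq_quotient.
Qed.

Lemma coord_le_norm (R : realType) n (x : 'rV[R]_n) i : `|x ord0 i| <= `|x|.
Proof.
rewrite [leRHS]/Num.Def.normr /= mx_normrE.
exact: (le_bigmax _ (fun ij : 'I_1 * 'I_n => `|x ij.1 ij.2|) (ord0, i)).
Qed.

Lemma norm_le_coord (R : realType) n (x : 'rV[R]_n) (e : R) :
  0 <= e -> (forall i, `|x ord0 i| <= e) -> `|x| <= e.
Proof.
move=> e0 xe; rewrite [leLHS]/Num.Def.normr /= mx_normrE.
apply/bigmax_leP; split => //.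
by move=> [i j] _ /=; rewrite [i]ord1.
Qed.

Section C1.
Context (R : realType) (n : nat).
Implicit Types g : 'rV[R]_n -> R.

Lemma partial_mvt g (y : 'rV[R]_n) (i : 'I_n) (t : R) :
  C1_on setT g ->
  exists2 c : R, `|c| <= `|t| &
    g (t *: delta_mx ord0 i + y) - g y =
    t * partial i g (c *: delta_mx ord0 i + y).
Proof.
move=> Cg; pose e : 'rV[R]_n := delta_mx ord0 i.
pose k (s : R) : R := g (s *: e + y).
have dk (s : R) : is_derive s 1 k (partial i g (s *: e + y)).
  by apply: is_derive_line; have [] := Cg (s *: e + y) I i.
have ck a b : {within `[a, b], continuous k}.
  by apply: derivable_within_continuous => s _; have [] := dk s.
have k0 : k 0 = g y by rewrite /k scale0r add0r.
have [t0|t0] := leP 0 t.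
  have [c] := MVT_segment t0 (fun s _ => dk s) (ck 0 t).
  rewrite in_itv /= k0 subr0 => /andP[c0 ct] ->.
  by exists c; rewrite 1?mulrC // !ger0_norm.
have [c] := MVT_segment (ltW t0) (fun s _ => dk s) (ck t 0).
rewrite in_itv /= k0 sub0r => /andP[tc c0] E.
exists c; first by rewrite !ler0_norm ?lerN2 // ltW.
by rewrite -[LHS]opprB E mulrN opprK mulrC.
Qed.

(** Going from x to h + x one coordinate at a time, the mean value theorem
    evaluates each step by a partial derivative at a point that is still within
    |h| of x, for the maximum norm. *)
Lemma C1_increment g (x h : 'rV[R]_n) (e : R) : C1_on setT g ->
  (forall y i, `|y - x| <= `|h| -> `|partial i g y - partial i g x| <= e) ->
  `|g (h + x) - g x - \sum_i h ord0 i * partial i g x| <= \sum_(i < n) e * `|h|.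
Proof.
move=> Cg near_x.
pose trunc k : 'rV[R]_n := \row_i (if (i < k)%N then h ord0 i else 0).
have trunc0 : trunc 0%N = 0 by apply/rowP => i; rewrite !mxE.
have truncn : trunc n = h by apply/rowP => i; rewrite !mxE ltn_ord.
have truncS (i : 'I_n) : trunc i.+1 = h ord0 i *: delta_mx ord0 i + trunc i.
  apply/rowP => j; rewrite !mxE eqxx ltnS leq_eqVlt /= -(inj_eq val_inj) /=.
  have [/eqP/val_inj -> |_] := boolP (val j == val i); last by rewrite mulr0 add0r.
  by rewrite mulr1 ltnn addr0.
have -> : g (h + x) - g x = \sum_(i < n) (g (trunc i.+1 + x) - g (trunc i + x)).
  rewrite -(big_mkord xpredT (fun i => g (trunc i.+1 + x) - g (trunc i + x))).
  by rewrite telescope_sumr // truncn trunc0 add0r.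
rewrite -sumrB; apply: le_trans (ler_norm_sum _ _ _) _.
apply: ler_sum => i _; rewrite truncS -(addrA (h ord0 i *: _)).
have [c ch ->] := partial_mvt (trunc i + x) i (h ord0 i) Cg.
rewrite -mulrBr normrM mulrC ler_pM ?coord_le_norm //.
apply: near_x; rewrite addrA addrK; apply: norm_le_coord => // j.
rewrite !mxE eqxx /= -(inj_eq val_inj) /=.
have [ji|ji] := boolP (val j == val i);
  rewrite ?(eqP ji) ?ltnn ?mulr1 ?mulr0 ?addr0.
  exact: le_trans ch (coord_le_norm _ _).
by rewrite add0r; case: ifP; rewrite ?normr0 ?coord_le_norm.
Qed.

(** [C1_increment], with the bound e as small as the continuity at x of the
    finitely many partial derivatives allows. *)
Lemma C1_diff g (x : 'rV[R]_n) : C1_on setT g ->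
  is_diff x g (fun u => \sum_i u ord0 i * partial i g x).
Proof.
move=> Cg; pose d (h : 'rV[R]_n) := \sum_i h ord0 i * partial i g x.
have lind : linear d.
  move=> a u v; rewrite /d scaler_sumr -big_split; apply: eq_bigr => i _.
  by rewrite !mxE mulrDl /= [_ *: _]mulrA.
pose dl : {linear _ -> _} := HB.pack d (GRing.isLinear.Build _ _ _ _ _ lind).
have cd : continuous d.
  have -> : d = \sum_i (fun h : 'rV[R]_n => h ord0 i * partial i g x).
    by apply/funext => u; rewrite fct_sumE.
  move=> u; apply: (@big_rec _ (fun k => {for u, continuous k})) => [|i k _ ck].
    exact: cst_continuous.
  apply: continuousD => //; apply: continuousM; last exact: cst_continuous.
  exact: coord_continuous.
have od : g \o shift x = cst (g x) + dl +o_ (nbhs (0 : 'rV[R]_n)) id.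
  apply/eqaddoP => _/posnumP[e]; pose e' := e%:num / n.+1%:R.
  (* The n coordinate steps share the error; n.+1 allows n = 0. *)
  have e'0 : 0 < e' by rewrite divr_gt0.
  have : \forall y \near x, forall i, `|partial i g y - partial i g x| <= e'.
    refine (@filter_forall _ 'I_n
      (fun i y => is_true (`|partial i g y - partial i g x| <= e')) (nbhs x) _ _).
    move=> i.
    have [_ ci] := Cg x I i.
    have /cvgrPdist_le/(_ _ e'0) := ci.
    by apply: filterS => y; rewrite distrC.
  move=> /nbhs_ballP[r /= r0 xr]; near=> h.
  have hr : `|h| < r.
    near: h; apply/nbhs_ballP; exists r => //= h; rewrite -ball_normE /=.
    by rewrite sub0r normrN.
  rewrite !fctE /= opprD addrA.
  apply: le_trans (C1_increment Cg (e := e') _) _.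
    move=> y i yh; apply: xr; rewrite -ball_normE /= distrC.
    exact: le_lt_trans yh hr.
  rewrite sumr_const card_ord -mulr_natr mulrAC ler_wpM2r //.
  rewrite /e' mulrAC -mulrA ler_piMr // ler_pdivrMr // mul1r ler_nat //.
have dE : 'd g x = dl :> (_ -> _).
  by apply: diff_unique; [exact: cd|exact: od].
split; last exact: dE.
by apply/diff_locallyP; rewrite dE.
Unshelve. all: by end_near. Qed.

Lemma C1_differentiable g x : C1_on setT g -> differentiable g x.
Proof. by move=> Cg; have [] := C1_diff x Cg. Qed.

Lemma C1_continuous g : C1_on setT g -> continuous g.
Proof. by move=> Cg x; exact/differentiable_continuous/C1_differentiable. Qed.

Lemma C1_deriveE g x v : C1_on setT g ->
  'D_v g x = \sum_i v ord0 i * partial i g x.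
Proof.
move=> Cg; have [dg dgE] := C1_diff x Cg.
by rewrite deriveE // dgE.
Qed.

End C1.

(** * Two-jets of -ln phi: locality, continuity and change of variables *)

Section C2.
Context (R : realType) (n : nat).
Implicit Types g h : 'rV[R]_n -> R.

Lemma is_derive_ln_comp g x v : differentiable g x -> 0 < g x ->
  is_derive x v (fun y => ln (g y)) ('D_v g x / g x).
Proof.
move=> dg gx; have dln : differentiable (@ln R) (g x).
  by apply/derivable1_diffP; have [] := is_derive1_ln gx.
have dc : differentiable (fun y => ln (g y)) x by exact: differentiable_comp.
apply: DeriveDef; first exact: diff_derivable.
rewrite deriveE // (_ : (fun y => ln (g y)) = @ln R \o g) // diff_comp //=.
rewrite diff1E // deriveE // derive1E; have [_ ->] := is_derive1_ln gx.
by [].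
Qed.

Lemma C1_onM g h : C1_on setT g -> C1_on setT h ->
  C1_on setT (fun x => g x * h x).
Proof.
move=> Cg Ch x _ i; have [dg cg] := Cg x I i; have [dh ch] := Ch x I i; split.
  exact: (derivableM dg dh).
have -> : partial i (fun x => g x * h x) =
    fun x => g x * partial i h x + h x * partial i g x.
  apply/funext => y; rewrite /partial.
  have [dgy _] := Cg y I i; have [dhy _] := Ch y I i.
  exact: (deriveM dgy dhy).
have cg' := C1_continuous Cg (x := x); have ch' := C1_continuous Ch (x := x).
exact: (continuousD (continuousM cg' ch) (continuousM ch' cg)).
Qed.

Lemma C1_onN g : C1_on setT g -> C1_on setT (fun x => - g x).
Proof.
move=> Cg x _ i; have [dg cg] := Cg x I i; split; first exact: derivableN.
have -> : partial i (fun x => - g x) = fun x => - partial i g x.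
  by apply/funext => y; have [dgy _] := Cg y I i; exact: (deriveN dgy).
exact: continuousN.
Qed.

Lemma C1_onV g : C1_on setT g -> (forall x, g x != 0) ->
  C1_on setT (fun x => (g x)^-1).
Proof.
move=> Cg g0 x _ i; have [dg cg] := Cg x I i; split; first exact: derivableV.
have -> : partial i (fun x => (g x)^-1) = fun x => - (g x)^-2 * partial i g x.
  apply/funext => y; have [dgy _] := Cg y I i; exact: (deriveV (g0 y) dgy).
have cg' := C1_continuous Cg (x := x).
have g20 : g x ^+ 2 != 0 by rewrite expf_neq0.
have c2 : {for x, continuous (fun y => g y ^+ 2)} by exact: (continuousM cg' cg').
have cV : {for x, continuous (fun y => g y ^- 2)} by exact: continuousV.
exact: (continuousM (continuousN cV) cg).
Qed.

Lemma partial_lnN g i : C1_on setT g -> (forall x, 0 < g x) ->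
  partial i (fun x => - ln (g x)) = fun x => - (partial i g x * (g x)^-1).
Proof.
move=> Cg g0; apply/funext => x.
have [dl lE] :=
  is_derive_ln_comp (delta_mx ord0 i) (C1_differentiable x Cg) (g0 x).
by rewrite /partial -lE; exact: (deriveN dl).
Qed.

Lemma C2_on_lnN g : C2_on setT g -> (forall x, 0 < g x) ->
  C2_on setT (fun x => - ln (g x)).
Proof.
move=> [C1g C2g] g0; have C1p i : C1_on setT (partial i (fun x => - ln (g x))).
  rewrite partial_lnN //; apply: C1_onN; apply: C1_onM (C2g i) _.
  by apply: C1_onV C1g _ => x; rewrite gt_eqF.
split=> [|//] x _ i; split; last exact: C1_continuous (C1p i) x.
have [dl _] :=
  is_derive_ln_comp (delta_mx ord0 i) (C1_differentiable x C1g) (g0 x).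
exact: derivableN.
Qed.

Lemma partial_eq_open (O : set 'rV[R]_n) g h i : open O ->
  {in O, g =1 h} -> {in O, partial i g =1 partial i h}.
Proof.
move=> oO gh x xO; apply: near_eq_derive.
have : nbhs x O by apply: open_nbhs_nbhs; split => //; rewrite inE in xO.
by apply: filterS => y Oy; apply: gh; rewrite inE.
Qed.

Lemma continuous_eq_closure (O : set 'rV[R]_n) g h :
  continuous g -> continuous h ->
  {in O, g =1 h} -> {in closure O, g =1 h}.
Proof.
move=> cg ch gh x; rewrite inE => xO.
apply/eqP; rewrite -subr_eq0; apply/eqP.
have cd : continuous (fun x => g x - h x).
  by move=> y; apply: continuousB; [exact: cg|exact: ch].
have cl : closed ((fun x => g x - h x) @^-1` [set 0]).
  by apply: closed_comp => [y _|]; [exact: cd|exact: closed_eq].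
suff: ((fun x => g x - h x) @^-1` [set 0]) x by [].
move/closure_id: cl => ->; apply: closureS xO => y Oy /=.
by rewrite gh ?subrr // inE.
Qed.

(** On O the functions have the same 2-jets because O is open; the 2-jets of C^2
    functions being continuous, they still agree on the boundary of O, where
    the functions may separate. *)
Lemma fdiv_arg_eq_closure (O : set 'rV[R]_n) g h : open O ->
  C2_on setT g -> C2_on setT h -> (forall x, 0 < g x) -> (forall x, 0 < h x) ->
  {in O, g =1 h} -> {in closure O, fdiv_arg g =1 fdiv_arg h}.
Proof.
move=> oO Cg Ch g0 h0 gh x xO.
have gx : g x = h x.
  by apply: continuous_eq_closure xO => //; apply: C1_continuous;
    [case: Cg|case: Ch].
have gradx : grad g x = grad h x.
  apply/rowP => i; rewrite !mxE.
  apply: (continuous_eq_closure _ _ (partial_eq_open i oO gh)) xO.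
  - by case: Cg => _ /(_ i)/C1_continuous.
  - by case: Ch => _ /(_ i)/C1_continuous.
have ghln : {in O, (fun x => - ln (g x)) =1 (fun x => - ln (h x))}.
  by move=> y Oy /=; rewrite gh.
suff hessx : hess (fun y => - ln (g y)) x = hess (fun y => - ln (h y)) x.
  by rewrite /fdiv_arg hessx gradx gx.
have [_ Cg'] := C2_on_lnN Cg g0; have [_ Ch'] := C2_on_lnN Ch h0.
apply/matrixP => i j; rewrite [LHS]mxE [RHS]mxE.
apply: (continuous_eq_closure _ _
  (partial_eq_open i oO (partial_eq_open j oO ghln))) xO.
- by move=> y; have [] := Cg' j y I i.
- by move=> y; have [] := Ch' j y I i.
Qed.

(** As A is linear, both sides have the same difference quotients. *)
Lemma is_derive_lin_comp (A : {linear 'rV[R]_n -> 'rV[R]_n}) g x v :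
  derivable g (A x) (A v) -> is_derive x v (g \o A) ('D_(A v) g (A x)).
Proof.
have eq_quotient :
    (fun t : R => t^-1 *: (((g \o A) \o shift x) (t *: v) - (g \o A) x)) =
    (fun t : R => t^-1 *: ((g \o shift (A x)) (t *: A v) - g (A x))).
  by apply/funext => t; rewrite /comp /shift /=; have /= -> := linearP A t v x.
by move=> dg; apply: DeriveDef; rewrite /derivable /derive eq_quotient.
Qed.

Lemma partial_lin_comp (A : {linear 'rV[R]_n -> 'rV[R]_n}) g i :
  C1_on setT g ->
  partial i (g \o A) = fun x => \sum_k lin1_mx A i k * partial k g (A x).
Proof.
move=> Cg; apply/funext => x.
have dg : derivable g (A x) (A (delta_mx ord0 i)).
  by apply: diff_derivable; exact: C1_differentiable.
have := @derive_val _ _ _ _ _ _ _ (is_derive_lin_comp dg); rewrite /partial => ->.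
rewrite C1_deriveE //; apply: eq_bigr => k _; congr (_ * _).
by rewrite mxE.
Qed.

Lemma hess_lin_comp (A : {linear 'rV[R]_n -> 'rV[R]_n}) g x : C2_on setT g ->
  hess (g \o A) x = lin1_mx A *m hess g (A x) *m (lin1_mx A)^T.
Proof.
move=> [Cg C2g]; apply/matrixP => i j; rewrite !mxE partial_lin_comp //.
have -> : (fun x => \sum_k lin1_mx A j k * partial k g (A x)) =
    \sum_k (lin1_mx A j k *: (partial k g \o A)).
  by apply/funext => y; rewrite fct_sumE.
have dk k : derivable (partial k g \o A) x (delta_mx ord0 i).
  apply: ex_derive; apply: is_derive_lin_comp.
  exact/diff_derivable/C1_differentiable.
have dZ k := @derivableZ _ _ _ _ (lin1_mx A j k) _ _ (dk k).
rewrite {1}/partial (derive_sum dZ).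
apply: eq_bigr => k _; rewrite (deriveZ _ (dk k)).
have := congr1 (@^~ x) (partial_lin_comp A i (C2g k)).
rewrite /partial /= => ->.
rewrite !mxE [_ *: _]mulrC; congr (_ * _); apply: eq_bigr => l _.
by rewrite !mxE.
Qed.

(** The gradient of g o A at x is the transpose of A applied to the gradient of
    g at A x, which moves A onto x in the scalar product; the Hessian of
    -ln (g o A) is congruent to that of -ln g by the matrix of A, and congruence
    multiplies the determinant by the square of det A. *)
Lemma fdiv_arg_lin_comp (A : {linear 'rV[R]_n -> 'rV[R]_n}) g x :
  \det (lin1_mx A) = 1 -> C2_on setT g -> (forall x, 0 < g x) ->
  fdiv_arg (g \o A) x = fdiv_arg g (A x).
Proof.
move=> detA Cg g0; rewrite /fdiv_arg /=.
have -> : dotv (grad (g \o A) x) x = dotv (grad g (A x)) (A x).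
  rewrite /dotv; have [C1g _] := Cg.
  under eq_bigr do rewrite mxE (partial_lin_comp _ _ C1g) mulr_suml.
  rewrite exchange_big; apply: eq_bigr => k _ /=.
  rewrite -(mul_rV_lin1 A x) !mxE mulr_sumr; apply: eq_bigr => i _; ring.
have := @hess_lin_comp A (fun y => - ln (g y)) x (C2_on_lnN Cg g0).
rewrite /comp => ->.
by rewrite !det_mulmx det_tr detA mulr1 mul1r.
Qed.

End C2.

(** * Matrices of determinant 1 preserve Lebesgue measure *)

Lemma lebesgue_measure_translate (R : realType) (t : R)
    (S : set (measurableTypeR R)) :
  measurable S ->
  lebesgue_measure ((fun x : measurableTypeR R => x + t) @^-1` S) =
  lebesgue_measure S.
Proof.
have mt : measurable_fun setT
    ((fun x => x + t) : measurableTypeR R -> measurableTypeR R).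
  by apply: measurable_funD => //; exact: measurable_cst.
pose T : {mfun measurableTypeR R >-> measurableTypeR R} :=
  HB.pack ((fun x => x + t) : measurableTypeR R -> measurableTypeR R)
    (isMeasurableFun.Build _ _ _ _ _ mt).
move=> mS; apply/esym.
apply: (@lebesgue_measure_unique R (pushforward lebesgue_measure T)) => //.
move=> _ [[a b] _ <-]; rewrite /pushforward /=.
rewrite [X in _ = lebesgue_measure X](_ : _ = `]a - t, b - t]%classic); last first.
  by apply/seteqP; split => x /=; rewrite !in_itv /= ltrBlDr lerBrDr.
rewrite !lebesgue_measure_itv /= !lte_fin ltrD2r -!EFinB.
by rewrite opprB addrA subrK.
Qed.

Section volume_preserving.
Context (R : realType).

Definition volume_preserving n (T : 'rV[R]_n -> 'rV[R]_n) :=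
  measurable_fun setT T /\
  forall S, measurable S -> lebesgue_rV R n (T @^-1` S) = lebesgue_rV R n S.

Lemma volume_preserving_id n : volume_preserving (@id 'rV[R]_n).
Proof. by split=> //; exact: measurable_id. Qed.

Lemma volume_preserving_comp n (T U : 'rV[R]_n -> 'rV[R]_n) :
  volume_preserving T -> volume_preserving U -> volume_preserving (T \o U).
Proof.
move=> [mT vT] [mU vU]; split; first exact: measurableT_comp.
move=> S mS; rewrite comp_preimage vU ?vT //.
by rewrite -[X in measurable X]setTI; exact: mT.
Qed.

Lemma lebesgue_rV_tail n S : measurable S ->
  lebesgue_rV R n.+1 S =
  (\int[lebesgue_measure]_x lebesgue_rV R n [set v | S (rV_cons (x, v))])%E.
Proof.
move=> mS; apply: eq_integral => x _ /=; congr (lebesgue_rV R n _).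
by apply/seteqP; split => v; rewrite /xsection /= inE.
Qed.

Lemma lebesgue_rV_head n S : measurable S ->
  lebesgue_rV R n.+1 S =
  (\int[lebesgue_rV R n]_v
     lebesgue_measure [set x : measurableTypeR R | S (rV_cons (x, v))])%E.
Proof.
move=> mS; have mS' : measurable (@rV_cons R n @^-1` S).
  by rewrite -[X in measurable X]setTI; exact: measurable_rV_cons.
have := indic_fubini_tonelli (@lebesgue_measure R) (lebesgue_rV R n) mS'.
rewrite indic_fubini_tonelli_FE // indic_fubini_tonelli_GE //.
rewrite [X in X = _](_ : _ = lebesgue_rV R n.+1 S) // => ->.
apply: eq_integral => v _ /=; congr (lebesgue_measure _).
by apply/seteqP; split => x; rewrite /ysection /= inE.
Qed.

Lemma measurable_tail_section n (S : set 'rV[R]_n.+1) (x : R) :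
  measurable S -> measurable [set v | S (rV_cons (x, v))].
Proof.
move=> mS; have mS' : measurable (@rV_cons R n @^-1` S).
  by rewrite -[X in measurable X]setTI; exact: measurable_rV_cons.
rewrite (_ : mkset _ = xsection (@rV_cons R n @^-1` S) x).
  exact: measurable_xsection.
by apply/seteqP; split => v; rewrite /xsection /= inE.
Qed.

Lemma measurable_head_section n (S : set 'rV[R]_n.+1) (v : 'rV[R]_n) :
  measurable S -> measurable [set x : measurableTypeR R | S (rV_cons (x, v))].
Proof.
move=> mS; have mS' : measurable (@rV_cons R n @^-1` S).
  by rewrite -[X in measurable X]setTI; exact: measurable_rV_cons.
rewrite (_ : mkset _ = ysection (@rV_cons R n @^-1` S) v).
  exact: measurable_ysection.
by apply/seteqP; split => x; rewrite /ysection /= inE.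
Qed.

(** Fubini: T moves the slice over each fixed first coordinate within itself. *)
Lemma volume_preserving_tail n (T : 'rV[R]_n.+1 -> 'rV[R]_n.+1)
    (tau : R -> 'rV[R]_n -> 'rV[R]_n) :
  measurable_fun setT T ->
  (forall x v, T (rV_cons (x, v)) = rV_cons (x, tau x v)) ->
  (forall x, volume_preserving (tau x)) -> volume_preserving T.
Proof.
move=> mT Tcons vtau; split=> // S mS.
have mTS : measurable (T @^-1` S) by rewrite -[X in measurable X]setTI; exact: mT.
rewrite !lebesgue_rV_tail //; apply: eq_integral => x _.
have [_ /(_ _ (measurable_tail_section x mS)) <-] := vtau x.
by congr (lebesgue_rV R n _); apply/seteqP; split => v /=; rewrite Tcons.
Qed.

(** Fubini in the other order: T slides each line parallel to the first axis
    along itself. *)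
Lemma volume_preserving_head n (T : 'rV[R]_n.+1 -> 'rV[R]_n.+1)
    (c : 'rV[R]_n -> R) :
  measurable_fun setT T ->
  (forall x v, T (rV_cons (x, v)) = rV_cons (x + c v, v)) -> volume_preserving T.
Proof.
move=> mT Tcons; split=> // S mS.
have mTS : measurable (T @^-1` S) by rewrite -[X in measurable X]setTI; exact: mT.
rewrite !lebesgue_rV_head //; apply: eq_integral => v _.
rewrite -(lebesgue_measure_translate (c v) (measurable_head_section v mS)).
by congr (lebesgue_measure _); apply/seteqP; split => x /=; rewrite Tcons.
Qed.

Lemma measurable_mulmx n (M : 'M[R]_n) :
  measurable_fun setT (mulmxr M : 'rV[R]_n -> _).
Proof.
apply: measurable_fun_rVP => j.
rewrite (_ : (fun t => _) =
  fun t : 'rV[R]_n => \sum_k t ord0 k * M k j); last first.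
  by apply/funext => t; rewrite /= !mxE.
apply: measurable_sum => k; apply: measurable_funM; last exact: measurable_cst.
exact: measurable_coord.
Qed.

Lemma measurable_addv n (t : 'rV[R]_n) :
  measurable_fun setT (fun x : 'rV[R]_n => x + t).
Proof.
apply: measurable_fun_rVP => j.
rewrite (_ : (fun u => _) =
  fun u : 'rV[R]_n => u ord0 j + t ord0 j); last first.
  by apply/funext => u; rewrite !mxE.
apply: measurable_funD; last exact: measurable_cst.
exact: measurable_coord.
Qed.

Lemma rV_consD n x y (u v : 'rV[R]_n) :
  rV_cons (x, u) + rV_cons (y, v) = rV_cons (x + y, u + v).
Proof.
have xyE : (x + y)%:M = x%:M + y%:M :> 'M[R]_1 by rewrite raddfD.
by rewrite /rV_cons /= xyE; exact: (@add_row_mx _ 1 1 n).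
Qed.

Lemma volume_preserving_translate n (t : 'rV[R]_n) :
  volume_preserving (fun x => x + t).
Proof.
elim: n t => [|n IHn] t.
  rewrite (_ : (fun x => x + t) = id); first exact: volume_preserving_id.
  by apply/funext => x; apply/rowP => -[].
pose t' := rV_uncons t.
have tE : t = rV_cons (0, t'.2) + rV_cons (t'.1, 0).
  rewrite rV_consD add0r addr0 -surjective_pairing.
  apply/rowP => i; rewrite /rV_cons /t' /=.
  case: (@split_ordP 1 n i) => j ->.
    rewrite [RHS]row_mxEl mxE [j]ord1 eqxx mulr1n.
    by congr (t _ _); exact/val_inj.
  by rewrite [RHS]row_mxEr mxE; congr (t _ _); exact/val_inj.
rewrite (_ : (fun x => x + t) =
    (fun x => x + rV_cons (t'.1, 0)) \o
    (fun x => x + rV_cons (0, t'.2))); last first.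
  by apply/funext => x /=; rewrite -addrA -tE.
apply: volume_preserving_comp.
  apply: (volume_preserving_head (c := fun=> t'.1)); first exact: measurable_addv.
  by move=> x v; rewrite rV_consD addr0.
apply: (volume_preserving_tail (tau := fun _ v => v + t'.2)) => //.
  exact: measurable_addv.
by move=> x v; rewrite rV_consD addr0.
Qed.

Definition volume_preserving_mx n (M : 'M[R]_n) := volume_preserving (mulmxr M).

Lemma volume_preserving_mxM n (M N : 'M[R]_n) :
  volume_preserving_mx M -> volume_preserving_mx N ->
  volume_preserving_mx (M *m N).
Proof.
move=> vM vN; have := volume_preserving_comp vN vM.
rewrite /volume_preserving_mx; congr volume_preserving.
by apply/funext => x /=; rewrite mulmxA.
Qed.

Lemma rV_cons_mul n x (v : 'rV[R]_n) a (b : 'rV[R]_n) (c : 'cV[R]_n) (D : 'M[R]_n) :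
  rV_cons (x, v) *m (block_mx a%:M b c D : 'M[R]_(1 + n)) =
  rV_cons (x * a + (v *m c) ord0 ord0, x *: b + v *m D).
Proof.
have xaE : (x * a + (v *m c) ord0 ord0)%:M = x%:M *m a%:M + v *m c :> 'M[R]_1.
  by rewrite raddfD /= scalar_mxM -mx11_scalar.
rewrite /rV_cons /= xaE -(mul_scalar_mx x b).
exact: (@mul_row_block _ 1 1 n 1 n).
Qed.

Lemma volume_preserving_upper n (b : 'rV[R]_n) :
  @volume_preserving_mx n.+1 (block_mx 1%:M b 0 1%:M : 'M[R]_(1 + n)).
Proof.
apply: (volume_preserving_tail (tau := fun x v => v + x *: b)).
- exact: measurable_mulmx.
- move=> x v; have := rV_cons_mul x v 1 b 0 1%:M => /= ->.
  by rewrite mulr1 mulmx0 mxE addr0 mulmx1 addrC.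
- by move=> x; exact: volume_preserving_translate.
Qed.

Lemma volume_preserving_lower n (c : 'cV[R]_n) :
  @volume_preserving_mx n.+1 (block_mx 1%:M 0 c 1%:M : 'M[R]_(1 + n)).
Proof.
apply: (volume_preserving_head (c := fun v => (v *m c) ord0 ord0)).
  exact: measurable_mulmx.
move=> x v; have := rV_cons_mul x v 1 0 c 1%:M => /= ->.
by rewrite mulr1 scaler0 add0r mulmx1.
Qed.

Lemma volume_preserving_diag n (D : 'M[R]_n) : volume_preserving_mx D ->
  @volume_preserving_mx n.+1 (block_mx 1%:M 0 0 D : 'M[R]_(1 + n)).
Proof.
move=> vD; apply: (volume_preserving_tail (tau := fun _ => mulmxr D)) => //.
  exact: measurable_mulmx.
move=> x v; have := rV_cons_mul x v 1 0 0 D => /= ->.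
by rewrite mulr1 scaler0 add0r mulmx0 mxE addr0.
Qed.

(** With pivot 1, clearing the first row and column by two shears leaves the
    Schur complement D - c b, again of determinant 1.  A pivot other than 1 would
    leave a scaling of the first axis. *)
Lemma volume_preserving_SL_pivot n (b : 'rV[R]_n) (c : 'cV[R]_n) (D : 'M[R]_n) :
  (forall M : 'M[R]_n, \det M = 1 -> volume_preserving_mx M) ->
  \det (block_mx 1%:M b c D : 'M[R]_(1 + n)) = 1 ->
  @volume_preserving_mx n.+1 (block_mx 1%:M b c D : 'M[R]_(1 + n)).
Proof.
move=> IH; have -> : (block_mx 1%:M b c D : 'M[R]_(1 + n)) =
    block_mx 1%:M 0 c 1%:M *m block_mx 1%:M 0 0 (D - c *m b) *m
    block_mx 1%:M b 0 1%:M.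
  rewrite !mulmx_block !(mul1mx, mulmx1, mulmx0, mul0mx, addr0, add0r).
  by rewrite addrC subrK.
rewrite !det_mulmx !det_lblock !det_ublock !det1 !mul1r mulr1 => /IH vD.
apply: volume_preserving_mxM; last exact: volume_preserving_upper.
apply: volume_preserving_mxM; first exact: volume_preserving_lower.
exact: volume_preserving_diag.
Qed.

(** A nonzero entry of c lets a row operation turn the pivot into 1. *)
Lemma volume_preserving_SL_col n (a : R) (b : 'rV[R]_n) (c : 'cV[R]_n)
    (D : 'M[R]_n) :
  (forall M : 'M[R]_n, \det M = 1 -> volume_preserving_mx M) -> c != 0 ->
  \det (block_mx a%:M b c D : 'M[R]_(1 + n)) = 1 ->
  @volume_preserving_mx n.+1 (block_mx a%:M b c D : 'M[R]_(1 + n)).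
Proof.
move=> IH c0 det1A.
have [i ci] : exists i, c i ord0 != 0.
  apply/existsP; apply: contra_neqT c0 => /existsPn c0.
  by apply/colP => i; rewrite mxE; apply/eqP; have := c0 i; rewrite negbK.
pose r : 'rV[R]_n := ((1 - a) / c i ord0) *: delta_mx ord0 i.
have rc : r *m c = (1 - a)%:M.
  rewrite [LHS]mx11_scalar; congr (_%:M).
  by rewrite -scalemxAl -rowE !mxE divfK.
have AE : (block_mx a%:M b c D : 'M[R]_(1 + n)) =
    block_mx 1%:M (- r) 0 1%:M *m block_mx 1%:M (b + r *m D) c D.
  rewrite mulmx_block !(mul1mx, mulmx1, mulmx0, mul0mx, addr0, add0r).
  by rewrite !mulNmx rc addrK -raddfB opprB addrC subrK.
rewrite AE; apply: volume_preserving_mxM; first exact: volume_preserving_upper.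
apply: volume_preserving_SL_pivot => //.
by move: det1A; rewrite AE det_mulmx det_ublock !det1 !mul1r.
Qed.

Theorem volume_preserving_SL n (M : 'M[R]_n) :
  \det M = 1 -> volume_preserving_mx M.
Proof.
elim: n M => [|n IHn] M.
  move=> _; rewrite /volume_preserving_mx.
  rewrite (_ : (mulmxr M : 'rV[R]_0 -> 'rV[R]_0) = id).
    exact: volume_preserving_id.
  by apply/funext => x; apply/rowP => -[].
rewrite -[M](@submxK R 1 n 1 n) [X in block_mx X]mx11_scalar.
set a := _ ord0 ord0; set b := ursubmx _; set c := dlsubmx _; set D := drsubmx _.
have [->|c0] := eqVneq c 0; last exact: volume_preserving_SL_col.
have [-> | a1] := eqVneq a 1; first exact: volume_preserving_SL_pivot.
move=> detA.
have {detA} det1A : \det (block_mx a%:M b 0 D : 'M[R]_(1 + n)) = 1 by [].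
(* Here c = 0 and a is neither 0 nor 1; for n > 0, adding the first row to the
   others makes the first column nonzero below the pivot. *)
have n0 : (0 < n)%N.
  rewrite lt0n; apply: contra_neqN a1 => /eqP n0.
  move: det1A; rewrite det_ublock det_scalar1.
  by clearbody b c D; subst n; rewrite det_mx00 mulr1.
pose w : 'cV[R]_n := const_mx 1.
have AE : (block_mx a%:M b 0 D : 'M[R]_(1 + n)) =
    block_mx 1%:M 0 (- w) 1%:M *m
    block_mx a%:M b (w *m a%:M) (w *m b + D).
  rewrite mulmx_block !(mul1mx, mulmx1, mulmx0, mul0mx, addr0, add0r).
  by rewrite !mulNmx addNr addKr.
have a0 : a != 0.
  apply/eqP => a0; move: det1A; rewrite a0 det_ublock det_scalar1 mul0r => /eqP.
  by rewrite eq_sym oner_eq0.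
rewrite AE; apply: volume_preserving_mxM; first exact: volume_preserving_lower.
apply: volume_preserving_SL_col => //.
  apply/eqP => /colP/(_ (Ordinal n0)); rewrite mul_mx_scalar !mxE mulr1 => /eqP.
  exact/negP.
by move: det1A; rewrite AE det_mulmx det_lblock !det1 !mul1r.
Qed.

Lemma integral_volume_preserving n (T : 'rV[R]_n -> 'rV[R]_n)
    (F : 'rV[R]_n -> \bar R) :
  volume_preserving T -> measurable_fun setT F ->
  (\int[lebesgue_rV R n]_x F (T x) = \int[lebesgue_rV R n]_x F x)%E.
Proof.
move=> [mT vT] mF.
pose T' : {mfun 'rV[R]_n >-> 'rV[R]_n} :=
  HB.pack T (isMeasurableFun.Build _ _ _ _ T mT).
have nonneg (G : 'rV[R]_n -> \bar R) :
    measurable_fun setT G -> (forall x, 0 <= G x)%E ->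
    (\int[lebesgue_rV R n]_x G (T x) = \int[lebesgue_rV R n]_x G x)%E.
  move=> mG G0; have := @ge0_integral_pushforward _ _ _ _ _ _ mT
    (lebesgue_rV R n) setT G measurableT mG (fun x _ => G0 x).
  rewrite preimage_setT => <-.
  apply: (@eq_measure_integral _ _ _ _ _ (pushforward (lebesgue_rV R n) T')).
  by move=> S mS _; exact: vT.
rewrite [LHS]integralE [RHS]integralE.
rewrite -(nonneg _ (measurable_funepos mF)) //.
rewrite -(nonneg _ (measurable_funeneg mF)) //.
by congr (_ - _)%E; apply: eq_integral => x _; rewrite !(funeposE, funenegE).
Qed.

End volume_preserving.

(** * The f-divergence *)

Lemma log_concave_gt0 (R : realType) n (phi : 'rV[R]_n -> R) :
  log_concave phi -> forall x, 0 < phi x.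
Proof. by move=> [psi _ phiE] x; rewrite phiE expR_gt0. Qed.

Lemma supp_setT (R : realType) n (phi : 'rV[R]_n -> R) :
  (forall x, 0 < phi x) -> supp phi = setT.
Proof. by move=> phi0; apply/seteqP; split=> // x _; exact: phi0. Qed.

Section valuation.
Context (R : realType) (n : nat) (f : R -> R).
Implicit Types g h : 'rV[R]_n -> R.

Lemma fdiv_integrand_eq_closure (O : set 'rV[R]_n) g h x : open O ->
  C2_on setT g -> C2_on setT h -> (forall y, 0 < g y) -> (forall y, 0 < h y) ->
  {in O, g =1 h} -> closure O x -> fdiv_integrand f g x = fdiv_integrand f h x.
Proof.
move=> oO Cg Ch g0 h0 gh xO; have {}xO : x \in closure O by rewrite inE.
rewrite /fdiv_integrand (fdiv_arg_eq_closure oO Cg Ch g0 h0 gh xO).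
congr (_%:E * _)%E; apply: continuous_eq_closure gh _ xO.
  by apply: C1_continuous; case: Cg.
by apply: C1_continuous; case: Ch.
Qed.

(** With L the set where g < h, on each of the open sets L and ~` closure L the
    maximum and the minimum are g and h in a fixed order, and the closures of
    these two sets cover R^n. *)
Lemma fdiv_integrand_max_min g h x :
  C2_on setT g -> C2_on setT h ->
  C2_on setT (g \max h) -> C2_on setT (g \min h) ->
  (forall y, 0 < g y) -> (forall y, 0 < h y) ->
  (fdiv_integrand f g x + fdiv_integrand f h x =
   fdiv_integrand f (g \max h) x + fdiv_integrand f (g \min h) x)%E.
Proof.
move=> Cg Ch CM Cm g0 h0.
have M0 y : 0 < (g \max h) y by rewrite /= lt_max g0.
have m0 y : 0 < (g \min h) y by rewrite /= lt_min g0 h0.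
pose L := [set y | g y < h y].
have oL : open L.
  have -> : L = (fun y => h y - g y) @^-1` [set t | 0 < t].
    by apply/seteqP; split=> y /=; rewrite subr_gt0.
  apply: open_comp; last exact: open_gt.
  have Cg' : C1_on setT g by case: Cg.
  have Ch' : C1_on setT h by case: Ch.
  move=> y _; have cg := C1_continuous Cg' (x := y).
  by have ch := C1_continuous Ch' (x := y); exact: (continuousB ch cg).
have [xL|xL] := pselect (closure L x).
  have hM : {in L, h =1 g \max h}.
    by move=> y; rewrite inE /L /= => /ltW gh; rewrite max_r.
  have gm : {in L, g =1 g \min h}.
    by move=> y; rewrite inE /L /= => /ltW gh; rewrite min_l.
  rewrite addeC (fdiv_integrand_eq_closure oL Ch CM h0 M0 hM xL).
  by rewrite (fdiv_integrand_eq_closure oL Cg Cm g0 m0 gm xL).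
have oU : open (~` closure L) by rewrite openC; exact: closed_closure.
have UL y : y \in ~` closure L -> h y <= g y.
  by rewrite inE leNgt => yL; apply/negP => ghy; apply: yL; exact: subset_closure.
have gM : {in ~` closure L, g =1 g \max h} by move=> y /UL hg; rewrite /= max_l.
have hm : {in ~` closure L, h =1 g \min h} by move=> y /UL hg; rewrite /= min_r.
have xU : closure (~` closure L) x by exact: subset_closure.
rewrite (fdiv_integrand_eq_closure oU Cg CM g0 M0 gM xU).
by rewrite (fdiv_integrand_eq_closure oU Ch Cm h0 m0 hm xU).
Qed.

End valuation.

Theorem corollary11 (R : realType) (n : nat) (f : R -> R)
    (hf : convex_or_concave f) :
  (forall (phi : 'rV[R]_n -> R) (A : {linear 'rV[R]_n -> 'rV[R]_n}),
     log_concave phi -> admissible f phi ->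
     self_adjoint A -> \det (lin1_mx A) = 1 ->
     fdiv f (phi \o A) = fdiv f phi) /\
  (forall phi1 phi2 : 'rV[R]_n -> R,
     log_concave phi1 -> log_concave phi2 -> log_concave (phi1 \max phi2) ->
     admissible f phi1 -> admissible f phi2 ->
     admissible f (phi1 \max phi2) -> admissible f (phi1 \min phi2) ->
     (fdiv f phi1 + fdiv f phi2 =
      fdiv f (phi1 \max phi2) + fdiv f (phi1 \min phi2))%E).
Proof.
split=> [phi A /log_concave_gt0 phi0 [_ C2phi _ intphi] _ detA|].
  have phiA0 x : 0 < (phi \o A) x by exact: phi0.
  move: C2phi intphi; rewrite /fdiv !supp_setT // => C2phi /measurable_int mphi.
  have volA : volume_preserving A.
    have := volume_preserving_SL detA; rewrite /volume_preserving_mx.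
    by congr volume_preserving; apply/funext => x /=; rewrite mul_rV_lin1.
  rewrite -(integral_volume_preserving volA mphi); apply: eq_integral => x _.
  by rewrite /fdiv_integrand fdiv_arg_lin_comp.
move=> phi1 phi2 /log_concave_gt0 p1 /log_concave_gt0 p2 /log_concave_gt0 pM.
have pm x : 0 < (phi1 \min phi2) x by rewrite /= lt_min p1 p2.
rewrite /admissible /fdiv !supp_setT //.
move=> -[_ C1 _ I1] [_ C2 _ I2] [_ CM _ IM] [_ Cm _ Im].
rewrite -(integralD measurableT I1 I2) -(integralD measurableT IM Im).
apply: eq_integral => x _.
exact: fdiv_integrand_max_min.
Qed.
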